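(* Let $p,q\in\mathbb{C}$ with $q\ne 0$, and let $(u_m)_{m\in\mathbb{Z}}$ be the sequence with $u_0=0$, $u_1=1$ and $u_m=pu_{m-1}-qu_{m-2}$ for all $m\in\mathbb{Z}$. Let $n\in\mathbb{N}$, $n\geq 1$, be fixed and let $X:\mathbb{Z}\to\mathbb{C}$ be a product of $n$ functions $\mathbb{Z}\to\mathbb{C}$, each of which satisfies the recurrence $W_m=pW_{m-1}-qW_{m-2}$ for all $m\in\mathbb{Z}$. Suppose that $u_1u_2\cdots u_{n+1}\neq 0$. Then for all $m\in\mathbb{Z}$, $$\sum_{i=0}^{n+1}(-1)^i q^{i(i-1)/2}\,(n+1|i)_u\,X(m-i)=0.$$
   Context: Generalised binomial coefficients: $(m|k)_u=1$ if $k=0$, and $$(m|k)_u=\frac{u_mu_{m-1}\cdots u_{m-k+1}}{u_ku_{k-1}\cdots u_1}\qquad\text{if }1\le k\le m.$$ The $n$ functions in the product need not be distinct and may have different initial values (in $\mathbb{C}$). *)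

(* Defs.v *)
From mathcomp Require Import all_boot all_order all_algebra.
From mathcomp Require Import complex.
From mathcomp Require Import reals.

Set Implicit Arguments.
Unset Strict Implicit.
Unset Printing Implicit Defensive.

Import GRing.Theory.

Local Open Scope ring_scope.

Definition lucas_rec (C : fieldType) (p q : C) (W : int -> C) : Prop :=
  forall m : int, W m = p * W (m - 1) - q * W (m - 2).

(* The generalised binomial coefficient (m|k)_u is only meaningful for k <= m
   and u_1, ..., u_k nonzero; elsewhere the value is arbitrary. *)
Definition gbinom (C : fieldType) (u : int -> C) (m k : nat) : C :=
  if k == 0%N then 1
  else (\prod_(0 <= j < k) u (m%:Z - j%:Z)) / (\prod_(1 <= j < k.+1) u j%:Z).

(* Main.v *)
Require Import Defs.
From mathcomp Require Import all_boot all_order all_algebra.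
From mathcomp Require Import complex.
From mathcomp Require Import reals.
From mathcomp Require Import ring zify.

Set Implicit Arguments.
Unset Strict Implicit.
Unset Printing Implicit Defensive.

Import GRing.Theory.

Local Open Scope ring_scope.

(** The identity holds over any field, by induction on the number of factors.
    The key is a three-term relation valid for every solution [W] of the
    recurrence,
      [u_(i+j) W(k+j) = u_j W(k+i+j) + q^j u_i W(k)],
    which says how [W] at a point between [k] and [k+i+j] is interpolated from
    its values at these two ends (lemma [lucas_interpolation]).  Write [c N i]
    for the coefficient [(-1)^i q^(i(i-1)/2) (N|i)_u].  Multiplied by [c], the
    interpolation relation becomes a twisted Pascal rule
      [c (n+1) (i+1) W(m-i-1) = W(m) c n (i+1) - q^n W(m-n-1) c n i]
    (lemma [signed_gbinom_pascal]) in which [W(m)] and [q^n W(m-n-1)] do not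
    depend on [i].  Hence, if [X = Y W], the sum of order [n+1] for [X] at [m]
    is a linear combination of the sums of order [n] for [Y] at [m] and at
    [m-1], and these vanish by induction.  The empty product is the constant 1,
    whose sum of order 1 is [1 - (1|1)_u = 0]. *)

Section Lucas.

Variables (C : fieldType) (p q : C) (u : int -> C).
Hypotheses (hu0 : u 0 = 0) (hu1 : u 1 = 1) (hu : lucas_rec p q u).

Lemma lucas_recS (W : int -> C) (hW : lucas_rec p q W) (m : int) :
  W (m + 2) = p * W (m + 1) - q * W m.
Proof. by rewrite hW addrK -addrA. Qed.

(** The difference [u_(j+1) W(k+j) - u_j W(k+j+1)] is a Casoratian of two
    solutions, hence is multiplied by [q] at each step; [W = u] and [k = 1]
    give Cassini's identity. *)
Lemma lucas_casoratian (W : int -> C) (hW : lucas_rec p q W) (k : int)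
    (j : nat) :
  u (j%:Z + 1) * W (k + j%:Z) = u j%:Z * W (k + j%:Z + 1) + q ^+ j * W k.
Proof.
elim: j => [|j IH]; first by rewrite add0r addr0 hu0 hu1 expr0 mul0r add0r.
have -> : j.+1%:Z + 1 = j%:Z + 2 by lia.
have -> : k + j.+1%:Z + 1 = k + j%:Z + 2 by lia.
have -> : k + j.+1%:Z = k + j%:Z + 1 by lia.
have -> : j.+1%:Z = j%:Z + 1 by lia.
rewrite !lucas_recS // exprS -mulrA.
have -> : q ^+ j * W k
    = u (j%:Z + 1) * W (k + j%:Z) - u j%:Z * W (k + j%:Z + 1).
  by rewrite IH addrC addKr.
by ring.
Qed.

(** Both sides satisfy the recurrence in [i], so it is enough to compare them
    at [i = 0] and [i = 1]. *)
Lemma lucas_interpolation (W : int -> C) (hW : lucas_rec p q W) (k : int)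
    (i j : nat) :
  u (j%:Z + i%:Z) * W (k + j%:Z)
    = u j%:Z * W (k + j%:Z + i%:Z) + q ^+ j * u i%:Z * W k.
Proof.
(* The second-order recurrence needs two consecutive values of i. *)
pose P i' := u (j%:Z + i'%:Z) * W (k + j%:Z)
    = u j%:Z * W (k + j%:Z + i'%:Z) + q ^+ j * u i'%:Z * W k.
suff [] : P i /\ P i.+1 by [].
elim: i => [|i [IH0 IH1]]; split => //; rewrite /P.
- by rewrite !addr0 hu0 mulr0 mul0r addr0.
- by rewrite hu1 mulr1; exact: lucas_casoratian.
have add2 (x : int) : x + i.+2%:Z = x + i%:Z + 2 by lia.
have add1 (x : int) : x + i.+1%:Z = x + i%:Z + 1 by lia.
have Ei2 : i.+2%:Z = i%:Z + 2 by lia.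
have Ei1 : i.+1%:Z = i%:Z + 1 by lia.
move: IH0 IH1; rewrite /P !add2 !add1 Ei2 Ei1 => IH0 IH1.
rewrite !lucas_recS // mulrBl -!mulrA IH1 IH0.
by ring.
Qed.

(** At [k = 0] both products are empty, so the case distinction in [gbinom]
    disappears. *)
Lemma gbinomE (m k : nat) :
  gbinom u m k
    = (\prod_(0 <= j < k) u (m%:Z - j%:Z)) / (\prod_(1 <= j < k.+1) u j%:Z).
Proof.
by rewrite /gbinom; case: k => //=; rewrite !big_geq // divr1.
Qed.

Lemma gbinom_num_recl (m k : nat) :
  \prod_(0 <= j < k.+1) u (m.+1%:Z - j%:Z)
    = u m.+1%:Z * \prod_(0 <= j < k) u (m%:Z - j%:Z).
Proof.
rewrite big_nat_recl // subr0; congr (_ * _).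
by apply: eq_bigr => j _; congr u; lia.
Qed.

Lemma gbinom_small (m : nat) : gbinom u m m.+1 = 0.
Proof. by rewrite gbinomE big_nat_recr //= subrr hu0 mulr0 mul0r. Qed.

Lemma mul_gbinom_top (m k : nat) :
  u m.+1%:Z * gbinom u m k = u (m.+1%:Z - k%:Z) * gbinom u m.+1 k.
Proof.
by rewrite !gbinomE mulrA -gbinom_num_recl big_nat_recr //= mulrCA !mulrA.
Qed.

Lemma mul_gbinom_diag (m k : nat) (hk : u k.+1%:Z != 0) :
  u m.+1%:Z * gbinom u m k = u k.+1%:Z * gbinom u m.+1 k.+1.
Proof.
rewrite !gbinomE mulrA -gbinom_num_recl (big_nat_recr k.+1) //= invfM.
by rewrite [RHS]mulrC -!mulrA mulVf // mulr1.
Qed.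

Definition signed_gbinom (m i : nat) : C :=
  (-1) ^+ i * q ^+ ((i * (i - 1)) %/ 2) * gbinom u m i.

Lemma triangularS (i : nat) :
  ((i.+1 * (i.+1 - 1)) %/ 2 = i + (i * (i - 1)) %/ 2)%N.
Proof.
have -> : (i.+1 * (i.+1 - 1) = i * 2 + i * (i - 1))%N.
  by case: i => // i; rewrite !subSS !subn0; lia.
by rewrite divnMDl.
Qed.

Lemma signed_gbinom_pascal (W : int -> C) (hW : lucas_rec p q W) (m : int)
    (n i : nat) (hin : (i <= n)%N) (hi : u i.+1%:Z != 0)
    (hn : u n.+1%:Z != 0) :
  signed_gbinom n.+1 i.+1 * W (m - i.+1%:Z)
    = W m * signed_gbinom n i.+1
      - q ^+ n * W (m - n.+1%:Z) * signed_gbinom n i.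
Proof.
apply: (mulfI hn).
have top := mul_gbinom_top n i.+1.
have diag := mul_gbinom_diag n hi.
have := lucas_interpolation hW (m - n.+1%:Z) i.+1 (n - i).
have -> : (n - i)%N%:Z + i.+1%:Z = n.+1%:Z by lia.
have -> : m - n.+1%:Z + (n - i)%N%:Z = m - i.+1%:Z by lia.
rewrite subrK => interp.
have Ej : n.+1%:Z - i.+1%:Z = (n - i)%N%:Z by lia.
have Eq : q ^+ n = q ^+ (n - i) * q ^+ i by rewrite -exprD subnK.
rewrite Ej in top.
rewrite /signed_gbinom triangularS exprS exprD Eq.
set g := gbinom u n.+1 i.+1 in top diag *.
set s := (-1) ^+ i; set a := q ^+ i; set b := q ^+ (_ %/ 2).
set d := q ^+ (n - i) in interp *.
transitivity (- (s * a * b * g) * (u n.+1%:Z * W (m - i.+1%:Z))).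
  by ring.
rewrite interp.
transitivity (- (W m * s * a * b) * (u n.+1%:Z * gbinom u n i.+1)
    - d * a * W (m - n.+1%:Z) * s * b * (u n.+1%:Z * gbinom u n i)).
  by rewrite top diag; ring.
by ring.
Qed.

Lemma signed_gbinom0 (m : nat) : signed_gbinom m 0 = 1.
Proof. by rewrite /signed_gbinom /gbinom /= div0n !mulr1. Qed.

Lemma signed_gbinom_sum_prod (n : nat) (W : 'I_n -> int -> C)
    (hW : forall j, lucas_rec p q (W j))
    (hun : forall k : nat, (k <= n)%N -> u k.+1%:Z != 0) (m : int) :
  \sum_(0 <= i < n.+2)
    signed_gbinom n.+1 i * \prod_(j < n) W j (m - i%:Z) = 0.
Proof.
elim: n => [|n IH] in W hW hun m *.
  rewrite big_nat_recr // big_nat1 /= !big_ord0 !mulr1 signed_gbinom0.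
  rewrite /signed_gbinom gbinomE !big_nat1 subr0 hu1 divr1 mulr1 /=.
  by rewrite div0n; ring.
pose Y m' := \prod_(j < n) W (widen_ord (leqnSn n) j) m'.
pose V := W ord_max.
have hV : lucas_rec p q V by exact: hW.
have sumY m' : \sum_(0 <= i < n.+2) signed_gbinom n.+1 i * Y (m' - i%:Z) = 0.
  by apply: (IH (fun j => W (widen_ord (leqnSn n) j))) => [j|k /leqW /hun].
have sumY_tail : \sum_(0 <= i < n.+2)
    signed_gbinom n.+1 i.+1 * Y (m - i.+1%:Z) = - Y m.
  (* The term of index n+2 added here is 0, by gbinom_small. *)
  have sumYr : \sum_(0 <= i < n.+3) signed_gbinom n.+1 i * Y (m - i%:Z) = 0.
    rewrite big_nat_recr //= sumY add0r.
    by rewrite /signed_gbinom gbinom_small mulr0 mul0r.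
  move: sumYr; rewrite big_nat_recl // signed_gbinom0 mul1r subr0.
  by move/eqP; rewrite addrC addr_eq0 => /eqP.
have prodE m' : \prod_(j < n.+1) W j m' = Y m' * V m'.
  by rewrite big_ord_recr.
rewrite big_nat_recl // prodE signed_gbinom0 mul1r subr0.
rewrite (eq_big_nat _ _ (F2 := fun i =>
    V m * (signed_gbinom n.+1 i.+1 * Y (m - i.+1%:Z))
    - q ^+ n.+1 * V (m - n.+2%:Z)
      * (signed_gbinom n.+1 i * Y (m - 1 - i%:Z)))); last first.
  move=> i /andP[_ hi]; rewrite prodE mulrCA (signed_gbinom_pascal hV) //.
  - have -> : m - 1 - i%:Z = m - i.+1%:Z by lia.
    by ring.
  - exact: hun.
  - exact: hun.
by rewrite sumrB -!mulr_sumr sumY_tail sumY mulr0 subr0 mulrN mulrC subrr.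
Qed.

End Lucas.

Theorem proposition3p2 (R : realType) (p q : R[i]) (u : int -> R[i])
    (n : nat) (W : 'I_n -> int -> R[i]) (X : int -> R[i])
    (hq : q != 0)
    (hu0 : u 0 = 0) (hu1 : u 1 = 1) (hu : lucas_rec p q u)
    (hn : (1 <= n)%N)
    (hW : forall j : 'I_n, lucas_rec p q (W j))
    (hX : forall m : int, X m = \prod_(j < n) W j m)
    (hun : \prod_(1 <= k < n.+2) u k%:Z != 0) :
  forall m : int,
    \sum_(0 <= i < n.+2)
      (-1) ^+ i * q ^+ ((i * (i - 1)) %/ 2) * gbinom u n.+1 i * X (m - i%:Z)
    = 0.
Proof.
move=> m; under eq_bigr do rewrite hX.
apply: (signed_gbinom_sum_prod hu0 hu1 hu hW) => k hk.
move: hun; rewrite prodf_seq_neq0 => /allP /(_ k.+1).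
by rewrite mem_index_iota /= ltnS; apply.
Qed.
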